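(* Let $a>0$, let $f:[0,a]\times\mathbb{R}^n\to\mathbb{R}^n$ be a continuous function, and suppose that there exists a real number $\eta>1$ such that $$\|f(t,u)+\eta u-f(t,v)-\eta v\|\le\|u-v\|$$ for all $t\in[0,a]$ and all $u,v\in\mathbb{R}^n$. Then the first-order periodic problem $$u'(t)=f(t,u(t)),\quad t\in[0,a],\qquad u(0)=u(a),$$ has a unique solution.
   Context: $\|(u_1,\dots,u_n)\|=\max\{|u_1|,\dots,|u_n|\}$ on $\mathbb{R}^n$. A solution is a function $u:[0,a]\to\mathbb{R}^n$, differentiable on $[0,a]$ (one-sided at the endpoints), satisfying the displayed equations. *)

(* Defs.v *)
From HB Require Import structures.
From mathcomp Require Import all_boot all_order all_algebra.
From mathcomp Require Import all_classical all_reals all_analysis.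

Set Implicit Arguments.
Unset Strict Implicit.
Unset Printing Implicit Defensive.

Import Order.TTheory GRing.Theory Num.Theory.
Import numFieldNormedType.Exports.

Local Open Scope classical_set_scope.
Local Open Scope ring_scope.

(* Difference quotients are only taken at points of [A]: on [A = `[0, a]] this
   is the two-sided derivative at interior points and the one-sided derivative
   at the endpoints, and it ignores the values of [u] outside [A]. *)
Definition has_derivative_on (R : realType) (n : nat) (A : set R)
    (u : R -> 'rV[R]_n) (t : R) (l : 'rV[R]_n) : Prop :=
  (s - t)^-1 *: (u s - u t) @[s --> within A t^'] --> l.

(* A function on [0, a] is represented by a total function on [R], of which
   only the values on [0, a] matter. *)
Definition periodic_solution (R : realType) (n : nat) (a : R)
    (f : R * 'rV[R]_n -> 'rV[R]_n) (u : R -> 'rV[R]_n) : Prop :=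
  (forall t, t \in `[0, a] -> has_derivative_on `[0, a] u t (f (t, u t))) /\
  u 0 = u a.

(* Main.v *)
Require Import Defs.
From HB Require Import structures.
From mathcomp Require Import all_boot all_order all_algebra.
From mathcomp Require Import all_classical all_reals all_analysis.
From mathcomp Require Import ring lra.

Set Implicit Arguments.
Unset Strict Implicit.
Unset Printing Implicit Defensive.

Import Order.TTheory GRing.Theory Num.Theory.
Import numFieldNormedType.Exports.

Local Open Scope classical_set_scope.
Local Open Scope ring_scope.

(** Write the equation as [u' + eta u = g(t, u)] with [g = f + eta u], which is
    1-Lipschitz in [u] for the maximum norm. The linear periodic problem
    [u' + eta u = h], [u 0 = u a] is solvable, and its solution satisfies the
    maximum principle [|u| <= sup |h| / eta]. Hence the map sending [w] to the
    solution for [h = g(t, w)] contracts the uniform distance by [1 / eta < 1],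
    and the same estimate applied to the difference of two solutions gives
    uniqueness. *)

(** * Norms and limits by coordinates *)

Lemma mx_norm_leP (K : realFieldType) m n (x : 'M[K]_(m, n)) (M : K) :
  0 <= M -> (`|x| <= M) <-> (forall i j, `|x i j| <= M).
Proof.
move=> M0; rewrite [leLHS]/Num.norm/= mx_normrE; split=> [/bigmax_leP[_ h] i j|h].
  exact: (h (i, j)).
by apply/bigmax_leP; split=> // -[i j] _; exact: h.
Qed.

Lemma cvg_coord (K : realFieldType) (T : Type) (F : set_system T) m n
    (u : T -> 'M[K]_(m, n)) (l : 'M[K]_(m, n)) : Filter F ->
  (forall i j, u x i j @[x --> F] --> l i j) -> u x @[x --> F] --> l.
Proof.
move=> FF h; apply/cvgrPdist_le => e e0.
have : \forall x \near F, forall i j, `|l i j - u x i j| <= e.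
  apply: filter_forall => i; apply: filter_forall => j.
  by move: (h i j) => /cvgrPdist_le; exact.
apply: filterS => x hx; apply/(mx_norm_leP _ (ltW e0)) => i j.
by rewrite !mxE.
Qed.

(** * Derivatives along a set *)

Section has_derivative_on_theory.
Context (R : realType) (n : nat).
Implicit Types (A : set R) (u v : R -> 'rV[R]_n) (t : R) (l k : 'rV[R]_n).

Lemma has_derivative_onB A u v t l k :
  has_derivative_on A u t l -> has_derivative_on A v t k ->
  has_derivative_on A (u - v) t (l - k).
Proof.
rewrite /has_derivative_on => ul vk; rewrite (_ : (fun s => _) =
    (fun s => (s - t)^-1 *: (u s - u t)) - (fun s => (s - t)^-1 *: (v s - v t))).
  exact: cvgB.
by apply/funext => s; rewrite !fctE -scalerBr opprD opprK addrACA opprD opprK.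
Qed.

Lemma has_derivative_on_within_continuous A u t l :
  has_derivative_on A u t l -> u @ within A (nbhs t) --> u t.
Proof.
move=> ul.
have st : (s - t) @[s --> within A t^'] --> (0 : R).
  apply: (@cvg_within_filter _ _ _ t^').
  apply: (@cvg_within_filter _ _ _ (nbhs t)).
  exact/subr_cvg0/cvg_id.
have /cvgrPdist_le h : (s - t) *: ((s - t)^-1 *: (u s - u t))
    @[s --> within A t^'] --> (0 : 'rV[R]_n).
  by rewrite -(scale0r l); exact: cvgZ.
apply/cvgrPdist_le => e /[dup] e0 /h.
apply: (@filterS _ (nbhs t)) => s hs As.
(* The punctured filter says nothing at [s = t], where the increment is zero. *)
have [->|nst] := eqVneq s t; first by rewrite subrr normr0 ltW.
have := hs nst As.
by rewrite scalerA divff ?subr_eq0// scale1r sub0r normrN distrC.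
Qed.

Lemma has_derivative_on_coord A u t l i : has_derivative_on A u t l ->
  (s - t)^-1 * (u s 0 i - u t 0 i) @[s --> within A t^'] --> l 0 i.
Proof.
move=> ul.
have cl : {for l, continuous (fun M : 'rV[R]_n => M 0 i)}.
  exact: coord_continuous.
rewrite (_ : (fun s => _) = (fun M : 'rV[R]_n => M 0 i) \o
    (fun s => (s - t)^-1 *: (u s - u t))); first exact: continuous_cvg.
by apply/funext => s; rewrite /= !mxE.
Qed.

(** The library derivative uses an increment tending to 0; substituting [s - t] for it gives the
    quotient used here. *)
Lemma is_derive_has_derivative_on A u t l :
  (forall i, is_derive t 1 (fun s => u s 0 i) (l 0 i)) ->
  has_derivative_on A u t l.
Proof.
move=> ul; apply: cvg_coord => i j; rewrite [i]ord1.
apply: (@cvg_within_filter _ _ _ t^').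
have [+ <-] := ul j; rewrite /derivable /derive => cv.
have st : (s - t) @[s --> t^'] --> 0^'.
  move=> P /= P0.
  have s0 : (s - t) @[s --> nbhs t] --> (0 : R) by exact/subr_cvg0/cvg_id.
  have := s0 _ P0.
  by apply: (@filterS _ (nbhs t)) => s /=; rewrite subr_eq0.
have := cvg_comp _ _ st cv.
apply: cvg_trans; apply: near_eq_cvg; apply: nearW => s /=.
by rewrite !mxE [_%:A]mulr1 subrK.
Qed.

End has_derivative_on_theory.

(** * Maximum principle for the linear equation *)

(* The maximum of [u i] may be taken at some [t > 0], since [u 0 = u a]; there
   the left derivative [h i - eta * u i] is nonnegative. *)
Lemma periodic_coord_le (R : realType) (n : nat) (a eta M : R)
    (u h : R -> 'rV[R]_n) (i : 'I_n) :
  0 < a -> 0 < eta ->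
  (forall t, t \in `[0, a] ->
    has_derivative_on `[0, a] u t (h t - eta *: u t)) ->
  u 0 = u a ->
  (forall t, t \in `[0, a] -> h t 0 i <= M) ->
  forall t, t \in `[0, a] -> u t 0 i <= M / eta.
Proof.
move=> a0 eta0 du u0a hM.
have cu : {within `[0, a], continuous (fun t => u t 0 i)}.
  apply/subspace_continuousP => t ta.
  have ut : {for u t, continuous (fun v : 'rV[R]_n => v 0 i)}.
    exact: coord_continuous.
  exact: continuous_cvg ut (has_derivative_on_within_continuous (du t ta)).
have [c c0a cmax] := EVT_max (ltW a0) cu.
have [d [d0 da dmax]] : exists d, [/\ 0 < d, d <= a &
    forall t, t \in `[0, a] -> u t 0 i <= u d 0 i].
  move: c0a; rewrite in_itv/= => /andP[]; rewrite le_eqVlt.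
  move=> /predU1P[c0|c0] ca; last by exists c.
  by exists a; split=> // t /cmax; rewrite -u0a c0.
have d0a : d \in `[0, a] by rewrite in_itv/= ltW.
suff ud : u d 0 i <= M / eta by move=> t /dmax/le_trans; apply.
have dd : (s - d)^-1 * (u s 0 i - u d 0 i) @[s --> d^'-] -->
    (h d - eta *: u d) 0 i.
  move=> P /(has_derivative_on_coord (i := i) (du d d0a)) dP.
  apply: (@filterS2 _ (nbhs d) _ _ _ _ _ dP (nbhs_left_gt d0)) => s h1 s0 sd.
  apply: h1; first by rewrite lt_eqF.
  by rewrite /= in_itv/= (ltW (s0 sd)) (le_trans (ltW sd)).
have : 0 <= (h d - eta *: u d) 0 i.
  apply: (cvgr_to_ge dd); near=> s.
  have sd : s < d by near: s; exact: nbhs_left_lt.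
  have s0 : 0 < s by near: s; exact: nbhs_left_gt.
  rewrite -mulrNN mulr_ge0// oppr_ge0 ?invr_le0 subr_le0 ?(ltW sd)//.
  by apply: dmax; rewrite in_itv/= (ltW s0) (le_trans (ltW sd)).
rewrite !mxE subr_ge0 => /le_trans /(_ (hM _ d0a)).
by rewrite ler_pdivlMr// mulrC.
Unshelve. all: by end_near. Qed.

(** The one-sided coordinate bound is applied to [u] and to [- u], which solves the same problem
    with [- h]. *)
Lemma periodic_norm_le (R : realType) (n : nat) (a eta M : R)
    (u h : R -> 'rV[R]_n) :
  0 < a -> 0 < eta ->
  (forall t, t \in `[0, a] ->
    has_derivative_on `[0, a] u t (h t - eta *: u t)) ->
  u 0 = u a ->
  (forall t, t \in `[0, a] -> `|h t| <= M) ->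
  forall t, t \in `[0, a] -> `|u t| <= M / eta.
Proof.
move=> a0 eta0 du u0a hM t ta.
have M0 : 0 <= M by exact: le_trans (hM _ ta).
apply/mx_norm_leP => [|i j]; first by rewrite divr_ge0// ltW.
rewrite [i]ord1 ler_norml lerNl; apply/andP; split.
  suff : (- u) t 0 j <= M / eta by rewrite mxE.
  apply: (periodic_coord_le (h := - h) a0 eta0 _ _ _ ta).
  - move=> s sa; rewrite (_ : _ - _ = 0 - (h s - eta *: u s)); last first.
      by rewrite sub0r !fctE scalerN opprK opprB addrC.
    rewrite -[- u]sub0r; apply: has_derivative_onB (du s sa).
    rewrite /has_derivative_on.
    rewrite (_ : (fun _ => _) = cst 0); first exact: cvg_cst.
    by apply/funext => r; rewrite subrr scaler0.
  - by rewrite !fctE u0a.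
  - move=> s /hM /(mx_norm_leP _ M0)/(_ 0 j).
    by rewrite mxE; apply: le_trans; rewrite -normrN ler_norm.
apply: periodic_coord_le du u0a _ t ta => // s /hM /(mx_norm_leP _ M0)/(_ 0 j).
by apply: le_trans; rewrite ler_norm.
Qed.

(** * Solving the linear periodic problem *)

Lemma continuous_antiderivative (R : realType) (g : R -> R) (b : R) :
  continuous g -> exists F, forall t, b < t -> is_derive t 1 F (g t).
Proof.
move=> cg; exists (fun x => \int[lebesgue_measure]_(s in `[b, x]) g s)%R => t bt.
have tt1 : t < t + 1 by rewrite ltrDl.
have ig : lebesgue_measure.-integrable `[b, t + 1] (EFin \o g).
  apply: continuous_compact_integrable; first exact: segment_compact.
  exact: continuous_subspaceT.
have [dF <-] := continuous_FTC1_closed tt1 ig bt (cg t).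
by rewrite derive1E; exact: DeriveDef.
Qed.

(** Integrating factor: the solutions are [expR (- eta * t) * (c + F t)] with [F] an antiderivative
    of [expR (eta * s) * h s]. *)
Lemma linear_periodic_scalar (R : realType) (a eta : R) (h : R -> R) :
  0 < a -> 0 < eta -> continuous h ->
  exists u, u 0 = u a /\
    forall t, t \in `[0, a] -> is_derive t 1 u (h t - eta * u t).
Proof.
move=> a0 eta0 ch.
have cg : continuous (fun s => expR (eta * s) * h s).
  move=> s; apply: cvgM; last exact: ch.
  apply: continuous_comp; last exact: continuous_expR.
  exact: mulrl_continuous.
(* Integrating from a negative point makes [F] differentiable on both sides at 0. *)
have [F dF] := continuous_antiderivative (-1) cg.
pose E t := expR (- eta * t).
have E1 : E a < 1 by rewrite expR_lt1 mulNr oppr_lt0 mulr_gt0.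
(* The root of [c + F 0 = E a * (c + F a)], which is the periodicity condition; [E a < 1] makes it
   solvable. *)
pose c := (E a * F a - F 0) / (1 - E a).
exists (E * (cst c + F)); split.
  rewrite !fctE/= /E mulr0 expR0 mul1r -/(E a).
  have : 1 - E a != 0 by rewrite subr_eq0 gt_eqF.
  by rewrite /c; move: (E a) (F a) (F 0) => x y z ?; field.
move=> t; rewrite in_itv/= => /andP[t0 _].
have dFt : is_derive t 1 F (expR (eta * t) * h t).
  by apply: dF; rewrite (lt_le_trans _ t0)// ltrN10.
have dE : is_derive t 1 E (E t * - eta).
  apply: is_derive1_comp.
  have := is_deriveZ (- eta) (is_derive_id t (1 : R)).
  by rewrite [_ *: _]mulr1.
apply: is_derive_eq.
have EE : E t * expR (eta * t) = 1 by rewrite -expRD mulNr addNr expR0.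
rewrite !fctE/= add0r /GRing.scale/= mulrA EE.
by move: (E t) (F t) => x y; ring.
Qed.

Lemma linear_periodic (R : realType) (n : nat) (a eta : R)
    (h : R -> 'rV[R]_n) :
  0 < a -> 0 < eta -> continuous h ->
  exists u, u 0 = u a /\ forall t, t \in `[0, a] ->
    has_derivative_on `[0, a] u t (h t - eta *: u t).
Proof.
move=> a0 eta0 ch.
have /choice[u hu] (i : 'I_n) : exists v, v 0 = v a /\
    forall t, t \in `[0, a] -> is_derive t 1 v (h t 0 i - eta * v t).
  apply: linear_periodic_scalar => // t.
  have ct : {for h t, continuous (fun v : 'rV[R]_n => v 0 i)}.
    exact: coord_continuous.
  exact: continuous_cvg ct (ch t).
exists (fun t => \row_i u i t); split.
  by apply/rowP => i; rewrite !mxE (hu i).1.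
move=> t ta; apply: is_derive_has_derivative_on => i.
rewrite (_ : (fun s => _) = u i); last by apply/funext => s; rewrite mxE.
by rewrite !mxE; exact: (hu i).2.
Qed.

(** Banach's fixed point theorem, phrased with pointwise bounds so that no metric on a function
    space is involved. The bound [D] on the first displacement makes the iterates uniformly Cauchy
    even if they are unbounded. *)
Lemma uniform_contraction_fixpoint (R : realType) (X : topologicalType) (n : nat)
    (q D : R) (T : (X -> 'rV[R]_n) -> (X -> 'rV[R]_n)) (w0 : X -> 'rV[R]_n) :
  0 <= q -> q < 1 ->
  (forall w, continuous w -> continuous (T w)) ->
  (forall (w1 w2 : X -> 'rV[R]_n) M, continuous w1 -> continuous w2 ->
    (forall x, `|w1 x - w2 x| <= M) ->
    forall x, `|T w1 x - T w2 x| <= q * M) ->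
  continuous w0 -> (forall x, `|T w0 x - w0 x| <= D) ->
  exists2 w, continuous w & T w =1 w.
Proof.
move=> q0 q1 Tc Tq w0c TD.
pose u k := iter k T w0.
have uc k : continuous (u k) by elim: k => //= k; exact: Tc.
(* The sum of the geometric series [D * q ^+ k]; the identity [q * K + D = K] closes the induction
   for [uD]. *)
pose K := D / (1 - q).
have KE : q * K + D = K.
  have : 1 - q != 0 by rewrite subr_eq0 gt_eqF.
  by rewrite /K => ?; field.
have uD : forall m x, `|u m x - u 0%N x| <= K.
  elim=> [|m IH] x.
    rewrite subrr normr0 divr_ge0 ?subr_ge0 ?(ltW q1)//.
    exact: le_trans (TD x).
  rewrite -(subrKA (u 1%N x)) -KE (le_trans (ler_normD _ _))//.
  by apply: lerD; [apply: Tq => // y; exact: uc|exact: TD].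
have ud : forall k m x, `|u (m + k)%N x - u k x| <= K * q ^+ k.
  elim=> [|k IH] m x; first by rewrite addn0 mulr1 uD.
  by rewrite addnS exprSr mulrA [leRHS]mulrC; apply: Tq => // y; exact: uc.
have small e : 0 < e -> exists k, K * q ^+ k <= e.
  move=> e0; have /cvgrPdist_le/(_ e e0) : K * q ^+ k @[k --> \oo] --> (0 : R).
    by apply: cvg_geometric; rewrite ger0_norm.
  case=> k _ /(_ k (leqnn k)); rewrite sub0r normrN => h.
  by exists k; apply: le_trans h; rewrite ler_norm.
have ucvg x : cvg (u k x @[k --> \oo]).
  apply/cauchy_cvgP/cauchy_exP => e e0.
  have [k ke] := small _ (divr_gt0 e0 (ltr0n _ 2)).
  exists (u k x); exists k => // m /= km.
  rewrite -ball_normE/= distrC -(subnK km) (le_lt_trans (ud _ _ _))//.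
  rewrite (le_lt_trans ke)//; lra.
pose w x := lim (u k x @[k --> \oo]).
(* Let [m] tend to infinity in [ud]. The bound is uniform in [x], so [w] inherits continuity from
   the iterates. *)
have wu k x : `|w x - u k x| <= K * q ^+ k.
  have h : `|u m x - u k x| @[m --> \oo] --> `|w x - u k x|.
    by apply: cvg_norm; apply: cvgB; [exact: ucvg|exact: cvg_cst].
  apply: (cvgr_to_le h); exists k => // l /= kl.
  by rewrite -(subnK kl) ud.
have wc : continuous w.
  move=> x; apply/cvgrPdist_le => e e0.
  have e3 : 0 < e / 3 by rewrite divr_gt0.
  have [k ke] := small _ e3.
  have /cvgrPdist_le/(_ _ e3) := uc k x.
  apply: (@filterS _ (nbhs x)) => y uxy.
  rewrite -(subrKA (u k x)) -(subrKA (u k y) (u k x)).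
  rewrite (le_trans (ler_normD _ _))//.
  have wuy : `|u k y - w y| <= e / 3 by rewrite distrC (le_trans (wu k y)).
  apply: le_trans (lerD (le_trans (wu k x) ke)
    (le_trans (ler_normD _ _) (lerD uxy wuy))) _.
  lra.
(* Both [T w] and [w] are within [q * (K * q ^+ k)] of [u k.+1]. *)
exists w => // x; apply/eqP; rewrite -subr_eq0 -normr_le0.
apply/ler_addgt0Pr => e e0; rewrite add0r.
have [k ke] := small _ (divr_gt0 e0 (ltr0n _ 2)).
rewrite -(subrKA (u k.+1 x)) (le_trans (ler_normD _ _))//.
have h1 := Tq _ _ _ wc (uc k) (wu k) x.
have := wu k.+1 x; rewrite distrC exprSr mulrA [K * _ * _]mulrC => h2.
have h3 : q * (K * q ^+ k) <= e / 2.
  apply: le_trans ke; rewrite ler_piMl ?(ltW q1)//.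
  by rewrite (le_trans _ (wu k x)).
rewrite (le_trans (lerD h1 h2))//; lra.
Qed.

(** * Passing to the interval, and the nonlinear problem *)

Lemma continuous_comp_within (X Y Z : topologicalType) (A : set Y)
    (phi : X -> Y) (psi : Y -> Z) :
  {within A, continuous psi} -> continuous phi -> (forall x, A (phi x)) ->
  continuous (psi \o phi).
Proof.
move=> /subspace_continuousP cpsi cphi Aphi x P /(cpsi _ (Aphi x)) /= /cphi.
by apply: (@filterS _ (nbhs x)) => y; apply.
Qed.

Lemma eq_has_derivative_on (R : realType) (n : nat) (A : set R)
    (u v : R -> 'rV[R]_n) (t : R) (l : 'rV[R]_n) :
  (forall s, A s -> u s = v s) -> A t ->
  has_derivative_on A u t l -> has_derivative_on A v t l.
Proof.
move=> uv At ul P /ul /=.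
apply: (@filterS _ t^') => s + As => /(_ As) /=.
by rewrite !uv.
Qed.

Theorem theorem3p1 (R : realType) (n : nat) (a : R)
    (f : R * 'rV[R]_n -> 'rV[R]_n)
    (a_gt0 : 0 < a)
    (f_cont : {within `[0, a] `*` [set: 'rV[R]_n], continuous f})
    (f_nonexp : exists2 eta : R, 1 < eta &
      forall t (u v : 'rV[R]_n), t \in `[0, a] ->
        `| f (t, u) + eta *: u - f (t, v) - eta *: v | <= `| u - v |) :
  exists2 u : R -> 'rV[R]_n, periodic_solution a f u &
    forall v : R -> 'rV[R]_n, periodic_solution a f v ->
      {in `[0, a], v =1 u}.
Proof.
have [eta eta1 f_lip] := f_nonexp.
have eta0 : 0 < eta by exact: lt_trans eta1.
(* Composing with the clamp [c] lets the fixed point theorem work with functions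
   continuous on the whole line and with uniform bounds there. *)
pose c (t : R) := Num.max 0 (Num.min t a).
have c_itv t : c t \in `[0, a].
  by rewrite in_itv/= le_max lexx/= ge_max (ltW a_gt0) ge_min lexx orbT.
have c_id t : t \in `[0, a] -> c t = t.
  by rewrite in_itv/= => /andP[t0 ta]; rewrite /c min_l// max_r.
have cc : continuous c.
  move=> t; apply: (@continuous_max _ _ (cst 0) (fun s => Num.min s a) t).
    exact: cvg_cst.
  by apply: (@continuous_min _ _ id (cst a)); [exact: cvg_id|exact: cvg_cst].
pose H (w : R -> 'rV[R]_n) t := f (c t, w (c t)) + eta *: w (c t).
have Hc w : continuous w -> continuous (H w).
  move=> wc.
  have wcc : continuous (w \o c).
    by move=> t; apply: continuous_comp; [exact: cc|exact: wc].
  move=> t; apply: cvgD; last by apply: cvgZr; exact: wcc.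
  apply: (continuous_comp_within (phi := fun t => (c t, w (c t))) f_cont) => s.
    exact: (cvg_pair (cc s) (wcc s)).
  by split => //; exact: c_itv.
have H_lip w1 w2 M : (forall t, `|w1 t - w2 t| <= M) ->
    forall t, `|(H w1 - H w2) t| <= M.
  move=> wM t; apply: le_trans (wM (c t)).
  by rewrite !fctE /H opprD addrA f_lip.
(* Choice needs a value of [T] at every [w], so the specification is guarded by continuity; a
   discontinuous [w] gets itself as a dummy value. *)
have /choice[T HT] w : exists v, continuous w ->
    [/\ continuous v, forall t, v t = v (c t), v 0 = v a &
    forall t, t \in `[0, a] ->
      has_derivative_on `[0, a] v t (H w t - eta *: v t)].
  have [wc|nwc] := pselect (continuous w); last by exists w => /nwc.
  have [u [u0a du]] := linear_periodic a_gt0 eta0 (Hc _ wc).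
  (* Clamping makes the solution constant on each side of the interval, hence continuous on the
     whole line, without changing its derivative along the interval. *)
  exists (u \o c) => _; split=> [|t||t ta].
  - apply: (continuous_comp_within (A := `[0, a])) => //.
    apply/subspace_continuousP => t ta.
    exact: has_derivative_on_within_continuous (du t ta).
  - by rewrite /= (c_id (c t)).
  - by rewrite /= !c_id// in_itv/= lexx ltW.
  - rewrite [(u \o c) t]/= c_id//.
    apply: (@eq_has_derivative_on _ _ _ u) (du t ta) => // s sa.
    by rewrite /= c_id.
(* By linearity [T w1 - T w2] solves the periodic problem for [H w1 - H w2], so the maximum
   principle gives the factor [eta^-1]. *)
have Tdiff w1 w2 M : continuous w1 -> continuous w2 ->
    (forall x, `|w1 x - w2 x| <= M) ->
    forall x, `|T w1 x - T w2 x| <= eta^-1 * M.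
  move=> w1c w2c wM x.
  have [_ T1c T10 dT1] := HT _ w1c; have [_ T2c T20 dT2] := HT _ w2c.
  rewrite T1c T2c mulrC.
  apply: (@periodic_norm_le _ _ a eta M (T w1 - T w2) (H w1 - H w2)) => //.
  - move=> t ta; have := has_derivative_onB (dT1 t ta) (dT2 t ta).
    by congr has_derivative_on; rewrite !fctE scalerBr !opprD opprK addrACA.
  - by rewrite !fctE T10 T20.
  - by move=> t _; exact: H_lip.
have c0 : continuous (cst 0 : R -> 'rV[R]_n) by exact: cst_continuous.
(* [H (cst 0)] is bounded on the compact interval, and the maximum principle transfers the bound to
   [T (cst 0)]. *)
have [D TD] : exists D, forall x, `|T (cst 0) x - cst 0 x| <= D.
  have [_ Tc T0 dT] := HT _ c0.
  have nc : {within `[0, a], continuous (fun t => `|H (cst 0) t|)}.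
    apply: continuous_subspaceT => t; apply: cvg_norm; exact: Hc.
  have [m _ hm] := EVT_max (ltW a_gt0) nc.
  exists (`|H (cst 0) m| / eta) => x; rewrite subr0 Tc.
  exact: periodic_norm_le dT T0 hm _ (c_itv x).
have [|||w wc Tw] := @uniform_contraction_fixpoint _ _ n eta^-1 D T (cst 0) _ _
  _ Tdiff c0 TD.
- by rewrite invr_ge0 ltW.
- by rewrite invf_lt1.
- by move=> v /HT[].
have {}Tw : T w = w by exact/funext.
have [_ _] := HT _ wc; rewrite Tw => w0a dw.
have sw : periodic_solution a f w.
  split=> // t ta; have := dw t ta.
  by rewrite /H c_id// addrK.
exists w => // v [dv v0a].
have nc : {within `[0, a], continuous (fun t => `|(v - w) t|)}.
  apply/subspace_continuousP => t ta; apply: cvg_norm.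
  apply: has_derivative_on_within_continuous.
  exact: has_derivative_onB (dv t ta) (dw t ta).
have [m ma hm] := EVT_max (ltW a_gt0) nc.
(* The forcing term of the linear equation solved by [v - w]; its norm is at most that of [v - w],
   hence at most the maximum, attained at [m]. *)
pose h t := f (t, v t) + eta *: v t - f (t, w t) - eta *: w t.
have hE t : t \in `[0, a] -> `|(v - w) t| <= `|(v - w) m| / eta.
  apply: (@periodic_norm_le _ _ a eta `|(v - w) m| (v - w) h) => // [s sa||s sa].
  - have := has_derivative_onB (dv s sa) (sw.1 s sa).
    congr has_derivative_on.
    by rewrite /h !fctE scalerBr opprB addrA subrK [RHS]addrAC addrK.
  - by rewrite !fctE v0a w0a.
  - by apply: le_trans (hm s sa); exact: f_lip.
(* At [t = m] the maximum is at most itself divided by [eta > 1]. *)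
have m0 : `|(v - w) m| <= 0.
  have := hE _ ma; rewrite ler_pdivlMr// -subr_le0.
  rewrite -{2}[`|_|]mulr1 -mulrBr => h0.
  have := normr_ge0 ((v - w) m); move: `|_| h0 => x; nra.
move=> t ta; apply/eqP; rewrite -subr_eq0 -normr_le0.
exact: le_trans (hm t ta) m0.
Qed.
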